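(* Let $\alpha$ be a given constant reset probability for PageRank. For any constants $\varepsilon<(1-\alpha)^3-\frac12$ and $\delta<1/4$, the following holds for all $n$: there is a family of directed graphs with no more than $n$ vertices and edges such that any random order streaming algorithm that, with probability $1-\delta$, returns an $\varepsilon$-additive approximation to the PageRank of vertex sets in these graphs uses $\Omega(n)$ bits of space, with the constant factor depending only on $\alpha$, $\varepsilon$ and $\delta$.
   Context: A random order streaming algorithm receives the edges of the input graph in a uniformly random order. For a directed graph on $N$ vertices in which every vertex has positive out-degree, the PageRank vector with reset probability $\alpha$ is the stationary distribution $p_\alpha$ of the Markov chain that at each step, with probability $1-\alpha$, moves along a uniformly random out-edge of the current vertex, and with probability $\alpha$ jumps to a uniformly random vertex; equivalently $p_\alpha=\alpha\frac{\mathbb 1}{N}+(1-\alpha)Mp_\alpha$ with $M$ the random walk transition matrix. The PageRank of a vertex set $S$ is $\sum_{u\in S}p_\alpha(u)$. *)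

(* Defs.v *)
From HB Require Import structures.
From mathcomp Require Import all_boot all_order all_algebra.
From mathcomp Require Import all_classical all_reals all_analysis.

Set Implicit Arguments.
Unset Strict Implicit.
Unset Printing Implicit Defensive.

Import Order.TTheory GRing.Theory Num.Theory.

Local Open Scope classical_set_scope.
Local Open Scope ring_scope.

Record digraph := Digraph {
  nverts : nat;
  edges : {set 'I_nverts * 'I_nverts};
  edges_loopless : forall v : 'I_nverts, (v, v) \notin edges
}.

Definition outdeg (G : digraph) (u : 'I_(nverts G)) : nat :=
  #|[pred v | (u, v) \in edges G]|.

(* Row convention: entry (u, v) is the probability of moving from u to v, so
   this is the transpose of the column-stochastic matrix M in
   p = alpha * 1/N + (1 - alpha) * M p. *)
Definition walk_mx (R : realType) (G : digraph) : 'M[R]_(nverts G) :=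
  \matrix_(u, v) (((u, v) \in edges G)%:R / (outdeg u)%:R).

Definition pagerank_chain (R : realType) (G : digraph) (alpha : R) :
    'M[R]_(nverts G) :=
  (1 - alpha) *: walk_mx R G + alpha *: const_mx ((nverts G)%:R^-1).

Definition is_distribution (R : realType) (N : nat) (p : 'rV[R]_N) : Prop :=
  (forall v, 0 <= p 0 v) /\ \sum_v p 0 v = 1.

(* For 0 < alpha <= 1 and positive out-degrees (and at least one vertex) there
   is exactly one such p. *)
Definition is_pagerank (R : realType) (G : digraph) (alpha : R)
    (p : 'rV[R]_(nverts G)) : Prop :=
  is_distribution p /\ p *m pagerank_chain G alpha = p.

Definition set_pagerank (R : realType) (N : nat) (p : 'rV[R]_N)
    (S : {set 'I_N}) : R :=
  \sum_(v in S) p 0 v.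

(* A randomized one-pass algorithm with s bits of memory, reading edges on the
   vertex set 'I_N.  The random seed is not charged to the space and may be
   reread at any time.  This subsumes fresh private coins at every step: no edge
   occurs twice in a stream, so the seed can hold independent coins for every
   pair (memory content, edge). *)
Record stream_alg (R : realType) (s N : nat) := StreamAlg {
  seed_disp : measure_display;
  seed : measurableType seed_disp;
  seed_law : probability seed R;
  init : seed -> s.-tuple bool;
  update : seed -> s.-tuple bool -> 'I_N * 'I_N -> s.-tuple bool;
  output : seed -> s.-tuple bool -> R;
  output_measurable : forall st : seq ('I_N * 'I_N),
    measurable_fun [set: seed]
      (fun w => output w (foldl (update w) (init w) st))
}.

Definition run (R : realType) (s N : nat) (A : stream_alg R s N)
    (w : seed A) (st : seq ('I_N * 'I_N)) : R :=
  output w (foldl (update w) (init w) st).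

Definition random_order_success (R : realType) (s : nat) (G : digraph)
    (A : stream_alg R s (nverts G)) (eps x : R) : \bar R :=
  (((#|edges G| `!)%:R^-1)%:E *
   \sum_(st <- permutations (enum (edges G)))
     seed_law A [set w | (`|run w st - x| <= eps)%R])%E.

(* The algorithm knows the vertex set and the queried set S in advance, at no
   cost in space; the guarantee is for each S separately. *)
Definition approximates_pagerank (R : realType) (s : nat)
    (A : forall N : nat, {set 'I_N} -> stream_alg R s N)
    (F : set digraph) (alpha eps delta : R) : Prop :=
  forall (G : digraph) (S : {set 'I_(nverts G)}) (p : 'rV[R]_(nverts G)),
    F G -> is_pagerank alpha p ->
    ((1 - delta)%:E <=
       random_order_success (A (nverts G) S) eps (set_pagerank p S))%E.

(* Main.v *)
(* Hard instances are functional graphs encoding an INDEX problem: data vertex j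
   points to one of two disjoint 2-cycles according to the bit x_j, a hub points
   to the data vertex i, and all but a small fraction of the n vertices are
   leaves pointing to the hub.  A walk restarted at a leaf reaches the cycle of
   x_i in three steps and stays there, so that cycle has PageRank about
   (1 - alpha)^3 and the other one at most the complement: an approximation
   within eps < (1 - alpha)^3 - 1/2 reveals x_i by comparison with 1/2.  With
   probability 1/2 the edge of i precedes the edge of the hub; the s bits kept
   at that moment must then serve all the possible i at once, and give an
   advantage over guessing of only O(sqrt (s / m)) per bit.  A success
   probability above 3/4 therefore forces s to be linear in m. *)
Require Import Defs.
From mathcomp Require Import all_boot all_order all_algebra.
From mathcomp Require Import all_classical all_reals all_analysis.
From mathcomp Require Import perm measurable_realfun zify ring lra.

Import Order.TTheory GRing.Theory Num.Theory.

Local Open Scope ring_scope.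

(** * Exponential moments and the advantage given by memory *)

(** Inverting [exp(- y) >= 1 - y] at [y = x / (1 + x)] gives [exp(x / (1 + x)) <= 1 + x]; and
    [x - 2 x^2 <= x / (1 + x)] because [1 + 2 x >= 0]. *)
Lemma expR_le1Dx {R : realType} {x : R} : - 2^-1 <= x -> expR (x - 2 * x ^+ 2) <= 1 + x.
Proof.
move=> hx; have x1 : 0 < 1 + x by lra.
have h : x - 2 * x ^+ 2 <= x / (1 + x).
  rewrite ler_pdivlMr //; suff : 0 <= x ^+ 2 * (1 + 2 * x) by nra.
  by rewrite mulr_ge0 ?sqr_ge0//; lra.
apply: (@le_trans _ _ (expR (x / (1 + x)))); first by rewrite ler_expR.
rewrite -[leRHS]invrK -[leLHS]invrK -expRN lef_pV2 ?posrE ?expR_gt0 ?invr_gt0//.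
apply: (le_trans _ (expR_ge1Dx _)); rewrite le_eqVlt; apply/orP; left; apply/eqP.
by field; rewrite gt_eqF.
Qed.

(** A right answer scores 1 and a wrong one -1, so sums of [pm] measure the advantage over fair
    guessing. *)
Definition pm {R : realType} (b : bool) : R := if b then 1 else -1.

(** [phi] replaces each bit in [B] by whether its guess is right. Guesses read only bits outside
    [B], which [phi] fixes, so [phi] is an involution; reindexing along it makes the factors
    independent, with mean 1. *)
Lemma sum_signed_prod {R : realType} {I : finType} {B : {set I}}
    {g : I -> {ffun I -> bool} -> bool} (t : R) :
  (forall (j : I) (x y : {ffun I -> bool}), {in ~: B, x =1 y} -> g j x = g j y) ->
  \sum_x \prod_(j in B) (1 + t * pm (g j x == x j)) = 2 ^+ #|I|.
Proof.
move=> hg.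
pose phi (x : {ffun I -> bool}) : {ffun I -> bool} :=
  [ffun j => if j \in B then g j x == x j else x j].
have gphi j x : g j (phi x) = g j x.
  by apply: hg => k; rewrite inE => /negbTE kB; rewrite ffunE kB.
have phiK : involutive phi.
  move=> x; apply/ffunP => j; rewrite ffunE; case: ifP => jB; last by rewrite ffunE jB.
  by rewrite gphi ffunE jB; case: (g j x); case: (x j).
rewrite (reindex_inj (inv_inj phiK)) /=.
transitivity (\sum_(x : {ffun I -> bool})
    \prod_(j : I) (if j \in B then 1 + t * pm (x j) else 1)).
  apply: eq_bigr => x _; rewrite [LHS]big_mkcond; apply: eq_bigr => j _.
  case: ifP => // jB; rewrite gphi ffunE jB.
  by case: (g j x); case: (x j).
rewrite -(bigA_distr_bigA (fun j b => if j \in B then 1 + t * pm b else 1)).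
rewrite -[#|I|]/(#|[pred _ : I | true]|) -prodr_const; apply: eq_bigr => j _.
by rewrite big_bool; case: ifP => _ /=; ring.
Qed.

(* The exponential moment of the advantage is at most the number of memory
   states, since without the memory each factor below has mean 1. *)
Lemma memory_advantage {R : realType} {I Q : finType} {B : {set I}}
    (mem : {ffun I -> bool} -> Q) {g : Q -> I -> {ffun I -> bool} -> bool}
    {t sb : R} :
  (forall q (j : I) (x y : {ffun I -> bool}), {in ~: B, x =1 y} -> g q j x = g q j y) ->
  0 < t <= 2^-1 -> #|Q|%:R <= expR sb ->
  \sum_x \sum_(j in B) pm (g (mem x) j x == x j)
    <= 2 ^+ #|I| * (2 * t * #|B|%:R + sb / t).
Proof.
move=> hg /andP[t0 t1] hQ.
pose D x : R := \sum_(j in B) pm (g (mem x) j x == x j).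
pose W q x : R := \prod_(j in B) (1 + t * pm (g q j x == x j)).
have W0 q x : 0 <= W q x.
  by apply: prodr_ge0 => j _; case: (_ == _); rewrite /pm; lra.
have hW x : expR (t * D x - 2 * t ^+ 2 * #|B|%:R) <= W (mem x) x.
  have -> : t * D x - 2 * t ^+ 2 * #|B|%:R =
      \sum_(j in B) (t * pm (g (mem x) j x == x j) - 2 * t ^+ 2).
    by rewrite sumrB mulr_sumr sumr_const mulr_natr.
  rewrite expR_sum; apply: ler_prod => j _; rewrite expR_ge0 /=.
  apply: (le_trans _ (expR_le1Dx _)); first by case: (_ == _); rewrite /pm ler_expR; nra.
  by case: (_ == _); rewrite /pm; lra.
have hsum : \sum_x expR (t * D x - 2 * t ^+ 2 * #|B|%:R) <= expR sb * 2 ^+ #|I|.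
  (* The true state [mem x] may depend on all of [x]; summing over every state [q], fixed in
     advance, removes this dependence. *)
  apply: (@le_trans _ _ (\sum_x \sum_q W q x)).
    apply: ler_sum => x _; apply: le_trans (hW x) _.
    by rewrite (bigD1 (mem x)) //= lerDl sumr_ge0.
  rewrite exchange_big /= (eq_bigr (fun=> 2 ^+ #|I|)); last first.
    by move=> q _; apply: sum_signed_prod; apply: hg.
  by rewrite sumr_const -[leLHS]mulr_natl ler_wpM2r// exprn_ge0.
have hcard : #|{ffun I -> bool}|%:R = 2 ^+ #|I| :> R.
  by rewrite card_ffun card_bool natrX.
(* Jensen's inequality for [expR], in the form [1 + y <= exp(y)] with [y] the exponent shifted by
   [sb]. *)
have hlin : \sum_x (t * D x - 2 * t ^+ 2 * #|B|%:R - sb) <= 0.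
  rewrite -(lerD2l (2 ^+ #|I|)) addr0 -{1}hcard -[X in X%:R]sum1_card.
  rewrite natr_sum -big_split /=.
  apply: (@le_trans _ _ (\sum_x expR (t * D x - 2 * t ^+ 2 * #|B|%:R) * expR (- sb))).
    apply: ler_sum => x _; rewrite -expRD. apply: expR_ge1Dx.
  by rewrite -mulr_suml expRN ler_pdivrMr ?expR_gt0// [leRHS]mulrC.
have sumc (c : R) : \sum_(x : {ffun I -> bool}) c = 2 ^+ #|I| * c.
  by rewrite sumr_const -[LHS]mulr_natl hcard.
move: hlin; rewrite 2!sumrB -mulr_sumr !sumc => h.
rewrite -(ler_pM2l t0) -/(\sum_x D x); set e := 2 ^+ #|I| in h *.
have -> : t * (e * (2 * t * #|B|%:R + sb / t)) = e * (2 * t ^+ 2 * #|B|%:R) + e * sb.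
  by field; rewrite gt_eqF.
by move: h; lra.
Qed.

(** * Averages over seeds and over stream orders *)

(** The bound at each outcome is integrated against [P]; this reduces a randomized algorithm to its
    runs with a fixed seed. *)
Lemma sum_probability_le {d : measure_display} {T : measurableType d} {R : realType}
    (P : probability T R) (I : Type) (r : seq I) (A : I -> set T) (C : R) :
  (forall i, measurable (A i)) ->
  (forall w, \sum_(i <- r) \1_(A i) w <= C) ->
  (\sum_(i <- r) P (A i) <= C%:E)%E.
Proof.
move=> mA hC.
have mf i : @measurable_fun _ _ T (\bar R) [set: T] (fun w => (\1_(A i) w)%:E).
  by apply/measurable_EFinP; apply: measurable_indic.
rewrite (eq_bigr (fun i => \int[P]_(w in [set: T]) (\1_(A i) w)%:E)%E); last first.
  by move=> i _; rewrite integral_indic// setIT.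
rewrite -ge0_integral_sum//.
have -> : C%:E = (\int[P]_(w in [set: T]) cst C%:E w)%E.
  rewrite integral_cst// -[LHS]mule1; congr (_ * _)%E.
  exact/esym/(probability_setT P).
apply: ge0_le_integral => //.
- by move=> w _; apply: sume_ge0 => i _; rewrite lee_fin.
- exact: emeasurable_sum.
- by move=> w _; rewrite sumEFin lee_fin.
Qed.

Lemma perm_permutations_map {T U : eqType} {f : T -> U} (s : seq T) :
  injective f ->
  perm_eq (permutations [seq f x | x <- s]) [seq [seq f x | x <- t] | t <- permutations s].
Proof.
move=> injf; apply: uniq_perm.
- exact: permutations_uniq.
- by rewrite map_inj_uniq ?permutations_uniq//; apply: inj_map.
move=> t; rewrite mem_permutations; apply/idP/mapP => [|[t' + ->]]; last first.
  by rewrite mem_permutations; apply: perm_map.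
(* A nonempty [s] supplies the default element of [nth], with which a permutation is written as a
   list of positions. *)
case: s => [|x0 s] h.
  by exists [::]; rewrite ?mem_permutations//; move/perm_nilP: h.
case/(perm_iotaP (f x0)): h => Is hIs ->.
exists [seq nth x0 (x0 :: s) i | i <- Is].
  rewrite mem_permutations; apply/(perm_iotaP x0); exists Is => //.
  by rewrite size_map in hIs.
rewrite -map_comp; apply/eq_in_map => i.
rewrite (perm_mem hIs) mem_iota add0n size_map => /andP[_ hi].
by rewrite (nth_map x0).
Qed.

(* Swapping a and b in the order exchanges the two events. *)
Lemma sum_index_ltn {V : finType} {a b : V} : a != b ->
  (2 * \sum_(s <- permutations (enum V)) (index a s < index b s) = (#|V|)`!)%N.
Proof.
move=> ab; set P := permutations (enum V).
have sw : (\sum_(s <- P) (index a s < index b s) = \sum_(s <- P) (index b s < index a s))%N.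
  pose f := tperm a b.
  have hP : perm_eq P [seq [seq f x | x <- s] | s <- P].
    apply: (perm_trans _ (perm_permutations_map (enum V) (@perm_inj _ f))).
    apply: perm_permutations; apply: uniq_perm; rewrite ?enum_uniq//.
      by rewrite map_inj_uniq ?enum_uniq//; apply: perm_inj.
    move=> x; rewrite mem_enum inE; apply/esym/mapP; exists (f x); rewrite ?mem_enum//.
    by rewrite tpermK.
  rewrite (perm_big _ hP) big_map; apply: eq_bigr => s _.
  have hi x : index x [seq f y | y <- s] = index (f x) s.
    by rewrite -{1}[x](tpermK a b) index_map//; apply: perm_inj.
  by rewrite !hi /f tpermL tpermR.
rewrite mul2n -addnn {2}sw -big_split /= (_ : (#|V|)`! = size P)%N; last by rewrite size_permutations ?enum_uniq -?cardE.
rewrite -sum1_size; apply: eq_big_seq => s; rewrite mem_permutations => /perm_mem hs.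
have : index a s != index b s.
  apply: contra ab => /eqP h.
  by rewrite -[a](nth_index a (s:=s)) ?hs ?mem_enum// h nth_index// hs mem_enum.
by case: ltngtP.
Qed.

(** * Existence of the PageRank vector *)

Lemma walk_mx_row_sum {R : realType} {G : digraph} {u : 'I_(nverts G)} :
  (0 < outdeg u)%N -> \sum_v walk_mx R G u v = 1.
Proof.
move=> hu; under eq_bigr do rewrite mxE.
rewrite -mulr_suml -natr_sum -big_mkcond /= sum1_card divff// pnatr_eq0 -lt0n.
exact: hu.
Qed.

Lemma walk_mx_ge0 (R : realType) {G : digraph} (u v : 'I_(nverts G)) :
  0 <= walk_mx R G u v.
Proof. by rewrite mxE divr_ge0. Qed.

(** The jump matrix has equal entries, so it sees only the total mass. The fixed-point equation
    becomes affine, which serves both existence and evaluation at a vertex. *)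
Lemma mul_pagerank_chain {R : realType} {G : digraph} (alpha : R) {p : 'rV[R]_(nverts G)} :
  \sum_v p 0 v = 1 ->
  p *m pagerank_chain G alpha =
    const_mx (alpha / (nverts G)%:R) + (1 - alpha) *: (p *m walk_mx R G).
Proof.
move=> p1; rewrite mulmxDr -!scalemxAr addrC; congr (_ + _).
apply/rowP => v; rewrite !mxE; under eq_bigr do rewrite mxE.
by rewrite -mulr_suml p1 mul1r.
Qed.

(* 1 - (1 - alpha) M is invertible because M contracts the l^1 norm; the
   solution is nonnegative because its l^1 norm does not exceed its sum. *)
Lemma pagerank_exists {R : realType} {G : digraph} {alpha : R} :
  0 < alpha <= 1 -> (0 < nverts G)%N ->
  (forall v : 'I_(nverts G), (0 < outdeg v)%N) ->
  exists p : 'rV[R]_(nverts G), is_pagerank alpha p.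
Proof.
move=> /andP[a0 a1] N0 hout; set N := nverts G; set M := walk_mx R G.
have contr (v : 'rV[R]_N) : \sum_j `|(v *m M) 0 j| <= \sum_i `|v 0 i|.
  apply: (@le_trans _ _ (\sum_j \sum_i `|v 0 i| * M i j)).
    apply: ler_sum => j _; rewrite mxE; apply: le_trans (ler_norm_sum _ _ _) _.
    by apply: ler_sum => i _; rewrite normrM (ger0_norm (walk_mx_ge0 _ _ _)).
  rewrite exchange_big /=; apply: ler_sum => i _.
  by rewrite -mulr_sumr walk_mx_row_sum ?mulr1.
pose B : 'M[R]_N := 1%:M - (1 - alpha) *: M.
have Bunit : B \in unitmx.
  rewrite -row_free_unit -kermx_eq0; apply/rowV0P => v /sub_kermxP.
  rewrite mulmxBr mulmx1 -scalemxAr => /subr0_eq hv.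
  have : \sum_i `|v 0 i| <= (1 - alpha) * \sum_i `|v 0 i|.
    rewrite {1}hv; under eq_bigr do rewrite mxE normrM.
    rewrite -mulr_sumr ger0_norm ?subr_ge0// ler_wpM2l ?subr_ge0//.
  have s0 : 0 <= \sum_i `|v 0 i| by apply: sumr_ge0.
  move=> hs; have {}hs : \sum_i `|v 0 i| = 0.
    by apply/eqP; rewrite eq_le s0 andbT; nra.
  apply/rowP => i; rewrite mxE; apply/normr0_eq0.
  by move/eqP: hs; rewrite psumr_eq0// => /allP/(_ i (mem_index_enum i))/eqP.
pose c : 'rV[R]_N := const_mx (alpha / N%:R).
have [p hp] : exists p : 'rV[R]_N, p = c + (1 - alpha) *: (p *m M).
  exists (c *m invmx B).
  have : c *m invmx B *m B = c by rewrite mulmxKV.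
  by rewrite {1}/B mulmxBr mulmx1 -scalemxAr => /(canRL (subrK _)).
have hpE i : p 0 i = c 0 i + (1 - alpha) * (p *m M) 0 i by rewrite {1}hp !mxE.
have c0 i : 0 <= c 0 i by rewrite mxE divr_ge0// ltW.
have NE : N%:R != 0 :> R by rewrite pnatr_eq0 -lt0n.
have csum : \sum_i c 0 i = alpha.
  under eq_bigr do rewrite mxE.
  by rewrite sumr_const card_ord -[_ *+ _]mulr_natr divfK.
have psum : \sum_i p 0 i = 1.
  have : \sum_i p 0 i = alpha + (1 - alpha) * \sum_i p 0 i.
    transitivity (\sum_i (c 0 i + (1 - alpha) * (p *m M) 0 i)).
      by apply: eq_bigr => i _; apply: hpE.
    rewrite big_split /= csum -mulr_sumr; congr (_ + _ * _).
    transitivity (\sum_j \sum_i p 0 i * M i j).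
      by apply: eq_bigr => j _; rewrite mxE.
    rewrite exchange_big /=. apply: eq_bigr => i _.
    by rewrite -mulr_sumr walk_mx_row_sum ?mulr1.
  by move=> h; apply: (mulfI (lt0r_neq0 a0)); lra.
have pabs : \sum_i `|p 0 i| <= 1.
  have : \sum_i `|p 0 i| <= alpha + (1 - alpha) * \sum_i `|p 0 i|.
    rewrite -{1}csum.
    apply: (@le_trans _ _ (\sum_i (c 0 i + (1 - alpha) * `|(p *m M) 0 i|))).
      apply: ler_sum => i _; rewrite {1}hpE.
      apply: le_trans (ler_normD _ _) _; rewrite normrM (ger0_norm (_ : 0 <= 1 - alpha)) ?subr_ge0//.
      by rewrite (ger0_norm (c0 i)).
    rewrite big_split /= -mulr_sumr lerD2l ler_wpM2l ?subr_ge0//.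
  by move=> h; rewrite -(ler_pM2l a0); lra.
exists p; split; last by rewrite mul_pagerank_chain.
split=> // v; have : \sum_i (`|p 0 i| - p 0 i) == 0.
  rewrite eq_le sumr_ge0 ?andbT; last by move=> i _; rewrite subr_ge0 ler_norm.
  by rewrite sumrB psum subr_le0.
rewrite psumr_eq0; last by move=> i _; rewrite subr_ge0 ler_norm.
by move=> /allP/(_ v (mem_index_enum v))/eqP/subr0_eq <-.
Qed.

(** * Digraphs of functions, with one out-edge per vertex *)

(** An edge is named by its source, so streams are orders of [V]; [enum_rank] transports [V] to the
    ordinals that [digraph] asks for. *)
Definition fun_edge {V : finType} (f : V -> V) (v : V) : 'I_#|V| * 'I_#|V| :=
  (enum_rank v, enum_rank (f v)).

Lemma fun_edge_inj {V : finType} (f : V -> V) : injective (fun_edge f).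
Proof. by move=> u v [] /enum_rank_inj. Qed.

Lemma mem_fun_edges {V : finType} (f : V -> V) (u v : V) :
  ((enum_rank u, enum_rank v) \in [set fun_edge f w | w in V]) = (f u == v).
Proof.
apply/imsetP/eqP => [[w _ [] /enum_rank_inj -> /enum_rank_inj ->] // | <-].
by exists u.
Qed.

Lemma fun_edges_loopless {V : finType} (f : V -> V) :
  (forall v, f v != v) -> forall v : 'I_#|V|, (v, v) \notin [set fun_edge f w | w in V].
Proof. by move=> hf v; rewrite -(enum_valK v) mem_fun_edges. Qed.

Definition fun_digraph {V : finType} {f : V -> V} (hf : forall v, f v != v) : digraph :=
  Digraph (fun_edges_loopless f hf).

Lemma outdeg_fun_digraph {V : finType} {f : V -> V} (hf : forall v, f v != v)
    (v : 'I_(nverts (fun_digraph hf))) : outdeg v = 1%N.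
Proof.
rewrite -[v]enum_valK; rewrite /outdeg -(card1 (enum_rank (f (enum_val v)))); apply: eq_card => w.
by rewrite -[w]enum_valK !inE mem_fun_edges (inj_eq enum_rank_inj) eq_sym.
Qed.

Lemma card_edges_fun_digraph {V : finType} {f : V -> V} (hf : forall v, f v != v) :
  #|edges (fun_digraph hf)| = #|V|.
Proof. by rewrite card_imset//; apply: fun_edge_inj. Qed.

(** Edge orders correspond to vertex orders. The range of summation no longer depends on [f], so all
    instances can be averaged over the same orders. *)
Lemma random_order_success_fun_digraph {R : realType} {s : nat} {V : finType}
    {f : V -> V} (hf : forall v, f v != v)
    (A : stream_alg R s #|V|) (eps x : R) :
  @random_order_success R s (fun_digraph hf) A eps x =
  (((#|V|)`!%:R^-1)%:E * \sum_(st <- permutations (enum V))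
     seed_law A [set w : seed A | (`|run w [seq fun_edge f v | v <- st] - x| <= eps)%R]%classic)%E.
Proof.
rewrite /random_order_success card_edges_fun_digraph; congr (_ * _)%E.
have h : perm_eq (permutations (enum (edges (fun_digraph hf))))
    [seq [seq fun_edge f v | v <- t] | t <- permutations (enum V)].
  apply: (perm_trans _ (perm_permutations_map (enum V) (fun_edge_inj f))).
  apply: perm_permutations; apply: uniq_perm; rewrite ?enum_uniq//.
    by rewrite map_inj_uniq ?enum_uniq//; apply: fun_edge_inj.
  move=> e; rewrite mem_enum /=; apply/imsetP/mapP => -[v hv ->]; exists v => //.
  by rewrite mem_enum.
by rewrite (perm_big _ h) /= big_map.
Qed.

Lemma fun_digraph_pagerankE {R : realType} {V : finType} {f : V -> V}
    (hf : forall v, f v != v) (alpha : R) (p : 'rV[R]_(nverts (fun_digraph hf))) :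
  is_pagerank alpha p -> forall v : V,
  p 0 (enum_rank v) = alpha / (#|V|)%:R + (1 - alpha) * \sum_(u | f u == v) p 0 (enum_rank u).
Proof.
move=> [[_ p1] hp] v; rewrite -{1}hp mul_pagerank_chain// !mxE; congr (_ + _ * _).
rewrite (reindex _ (onW_bij _ (@enum_rank_bij V))) /= [RHS]big_mkcond /=.
apply: eq_bigr => u _; rewrite mxE outdeg_fun_digraph divr1 mem_fun_edges.
by case: eqP; rewrite ?mulr1 ?mulr0.
Qed.

(** * The hard instances and their PageRank *)

(* [inl (c, _)] is a directed 2-cycle for each bit c, [inr None] a hub fed by
   the 'I_L leaves; the data vertex j < m points to the cycle of its bit. *)
Definition vertex (m L : nat) : finType := ((bool * bool) + option ('I_m + 'I_L))%type.

Definition hub {m L : nat} : vertex m L := inr None.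
Definition data {m L : nat} (j : 'I_m) : vertex m L := inr (Some (inl j)).

(** The hub's target [y] is kept free: a data vertex in an instance, a placeholder in the part of
    the stream before the hub. The trap is a 2-cycle because loops are excluded. *)
Definition wire {m L : nat} (x : {ffun 'I_m -> bool}) (y : vertex m L)
    (v : vertex m L) : vertex m L :=
  match v with
  | inl (c, b) => inl (c, ~~ b)
  | inr None => y
  | inr (Some (inl j)) => inl (x j, true)
  | inr (Some (inr _)) => hub
  end.

Lemma wire_neq {m L : nat} (x : {ffun 'I_m -> bool}) (i : 'I_m) (v : vertex m L) :
  wire x (data i) v != v.
Proof. by case: v => [[c b]|[[j|l]|]] //; apply/eqP => -[]; case: b. Qed.

Definition index_graph {m : nat} (L : nat) (x : {ffun 'I_m -> bool}) (i : 'I_m) : digraph :=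
  fun_digraph (wire_neq (L := L) x i).

Definition cycle_set {m L : nat} (c : bool) : {set 'I_#|vertex m L|} :=
  [set enum_rank (inl (c, true) : vertex m L); enum_rank (inl (c, false) : vertex m L)].

(** Each leaf has mass at least [alpha / N], and a fraction [1 - alpha] of the mass passes along
    each edge from leaf to hub to [data i] to the cycle, where it accumulates. *)
Lemma index_graph_pagerank_ge {R : realType} {m L : nat} (x : {ffun 'I_m -> bool})
    (i : 'I_m) (alpha : R) (p : 'rV[R]_(nverts (index_graph L x i))) :
  0 < alpha <= 1 -> is_pagerank alpha p ->
  (1 - alpha) ^+ 3 * (L%:R / (#|vertex m L|)%:R) <= set_pagerank p (cycle_set (x i)).
Proof.
move=> /andP[a0 a1] hp; pose f := wire x (data i : vertex m L).
pose q v : R := p 0 (enum_rank v); set N := #|vertex m L|.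
have q0 v : 0 <= q v by apply: (hp.1.1).
have qE v : q v = alpha / N%:R + (1 - alpha) * \sum_(u | f u == v) q u.
  exact: fun_digraph_pagerankE hp v.
have b0 : 0 <= 1 - alpha by lra.
have aN : 0 <= alpha / N%:R by rewrite divr_ge0// ltW.
have qge u : (1 - alpha) * q u <= q (f u).
  rewrite [leRHS]qE (bigD1 u) //= mulrDr.
  have : 0 <= (1 - alpha) * \sum_(w | (f w == f u) && (w != u)) q w.
    by rewrite mulr_ge0// sumr_ge0.
  lra.
have qhub : (1 - alpha) * (L%:R * (alpha / N%:R)) <= q hub.
  rewrite qE; suff : L%:R * (alpha / N%:R) <= \sum_(u | f u == hub) q u by nra.
  apply: (@le_trans _ _ (\sum_(u | f u == hub) alpha / N%:R)); last first.
    apply: ler_sum => u _; rewrite qE lerDl mulr_ge0// sumr_ge0//.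
  rewrite sumr_const -[leRHS]mulr_natl ler_wpM2r// ler_nat.
  have inj : injective (fun l : 'I_L => inr (Some (inr l)) : vertex m L) by move=> ? ? [].
  rewrite -{1}[L]card_ord -cardsT -(card_imset _ inj).
  apply: subset_leq_card; apply/fintype.subsetP => v /imsetP[l _ ->].
  exact: eqxx.
have qdata : (1 - alpha) * q hub <= q (data i) by exact: (qge hub).
have qt : (1 - alpha) * q (inl (x i, true)) <= q (inl (x i, false)) by exact: qge.
have qd : (1 - alpha) * (q (data i) + q (inl (x i, false))) <= q (inl (x i, true)).
  rewrite [leRHS]qE (bigD1 (data i)) //= (bigD1 (inl (x i, false))) ?eqxx //=.
  have : 0 <= \sum_(w | (f w == inl (x i, true)) && (w != data i) && (w != inl (x i, false))) q w.
    exact: sumr_ge0.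
  nra.
rewrite /set_pagerank /cycle_set.
rewrite big_setU1 ?big_set1; last by rewrite inE; apply/eqP => /enum_rank_inj.
(* Adding [qt] and [qd], the mass [T] of the cycle satisfies [T >= (1 - alpha) * (q (data i) + T)],
   so [alpha * T >= (1 - alpha) * q (data i)]. This [alpha] cancels the one in the mass of the
   leaves. *)
rewrite -/(q (inl (x i, true))) -/(q (inl (x i, false))) -(ler_pM2l a0).
have -> : alpha * ((1 - alpha) ^+ 3 * (L%:R / N%:R)) =
  (1 - alpha) ^+ 2 * ((1 - alpha) * (L%:R * (alpha / N%:R))) by ring.
apply: (@le_trans _ _ ((1 - alpha) ^+ 2 * q hub)).
  by rewrite ler_wpM2l// exprn_ge0.
have : (1 - alpha) * ((1 - alpha) * q hub) <= (1 - alpha) * q (data i) by rewrite ler_wpM2l.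
rewrite /=; lra.
Qed.

Lemma set_pagerank_le1 {R : realType} {N : nat} (p : 'rV[R]_N) (S : {set 'I_N}) :
  is_distribution p -> set_pagerank p S <= 1.
Proof.
by move=> [p0 <-]; rewrite [leRHS](bigID (mem S)) /= lerDl sumr_ge0.
Qed.

Lemma cycle_set_pagerankD {R : realType} {m L : nat} (p : 'rV[R]_#|vertex m L|) (c : bool) :
  is_distribution p ->
  set_pagerank p (cycle_set c) + set_pagerank p (cycle_set (~~ c)) <= 1.
Proof.
move=> hp; rewrite /set_pagerank -bigU /=.
  rewrite (eq_bigl (mem (cycle_set c :|: cycle_set (~~ c)))); last by move=> v; rewrite !inE.
  exact: set_pagerank_le1.
apply/pred0P => v /=; rewrite !inE; apply/negbTE.
by apply/andP => -[/orP[] /eqP -> /orP[] /eqP /enum_rank_inj[]]; case: c.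
Qed.

Lemma card_vertex (m L : nat) : #|vertex m L| = (m + L + 5)%N.
Proof. by rewrite card_sum card_option card_sum card_prod card_bool !card_ord addnC -addSnnS. Qed.

(** * From streaming algorithms to guessing bits *)

(** The bits that only the memory can convey once the hub's edge reveals the query. *)
Definition data_before_hub {m L : nat} (st : seq (vertex m L)) : {set 'I_m} :=
  [set j | (index (data j) st < index hub st)%N].

Lemma sum_card_data_before_hub {m L : nat} :
  (2 * \sum_(st <- permutations (enum (vertex m L))) #|data_before_hub st|
    = m * (#|vertex m L|)`!)%N.
Proof.
under eq_bigr do rewrite cardsE -sum1_card big_mkcond /=.
rewrite exchange_big big_distrr /=.
transitivity (\sum_(j < m) (#|vertex m L|)`!)%N; last by rewrite sum_nat_const card_ord.
by apply: eq_bigr => j _; rewrite -(@sum_index_ltn (vertex m L) (data j) hub)//.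
Qed.

(** Decodes the bit from an estimate for [cycle_set true], which is above 1/2 exactly when the bit
    is set, if the estimate is accurate. *)
Definition answer_bit {R : realType} {m L s : nat} {A : stream_alg R s #|vertex m L|}
    (w : seed A) (x : {ffun 'I_m -> bool}) (i : 'I_m) (st : seq (vertex m L)) : bool :=
  2^-1 < run w [seq fun_edge (wire x (data i)) v | v <- st].

(* The state reached just before the hub's edge does not depend on the queried
   index i, and the rest of the stream does not depend on the bits of x whose
   edges came earlier. *)
Lemma answer_bit_advantage {R : realType} {m L s : nat}
    {A : stream_alg R s #|vertex m L|} (w : seed A) {st : seq (vertex m L)} {t : R} :
  uniq st -> hub \in st -> 0 < t <= 2^-1 ->
  \sum_x \sum_i pm (answer_bit w x i st == x i) <=
    2 ^+ m * (2 * t * m%:R + s%:R / t + #|~: data_before_hub st|%:R) :> R.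
Proof.
move=> ust hst /[dup] /andP[t0 _] ht; set B := data_before_hub st.
pose k := index hub st.
(* The first [k] items do not contain the hub, so the target [hub] is a placeholder that makes the
   state independent of the query. *)
pose state x : s.-tuple bool :=
  foldl (update w) (init w) [seq fun_edge (wire x hub) v | v <- take k st].
pose g q j x := 2^-1 <
  output w (foldl (update w) q [seq fun_edge (wire x (data j)) v | v <- drop k st]).
have answerE x j : answer_bit w x j st = g (state x) j x.
  rewrite /answer_bit /run -{1}(cat_take_drop k st) map_cat foldl_cat /g /state.
  do 4 f_equal; apply/eq_in_map => v hv.
  rewrite /fun_edge; congr (_, enum_rank _).
  case: v hv => [[c b]|[[l|l]|]] // hv.
  by have := in_take k hst; rewrite hv /k ltnn.
have gB q j (x y : {ffun 'I_m -> bool}) : {in ~: B, x =1 y} -> g q j x = g q j y.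
  move=> xy; rewrite /g; do 3 f_equal; apply/eq_in_map => v hv.
  rewrite /fun_edge; congr (_, enum_rank _).
  case: v hv => [[c b]|[[l|l]|]] // hv; rewrite /= xy// !inE -in_take ?(mem_drop hv)//.
  move: ust; rewrite -{1}(cat_take_drop k st) cat_uniq => /and3P[_ /hasPn h _].
  exact: h.
(* There are [2^s] states, and [e >= 1 + 1]. *)
have cardQ : #|{: s.-tuple bool}|%:R <= expR s%:R :> R.
  rewrite card_tuple card_bool natrX -[s%:R]mulr1 expRM_natl.
  by rewrite lerXn2r ?nnegrE ?expR_ge0//; have := expR_ge1Dx (1 : R); lra.
have := memory_advantage state gB ht cardQ; rewrite card_ord => adv.
(* Bits outside [B] arrive after the query is known and are conceded in full. *)
have split_sum x : \sum_i pm (answer_bit w x i st == x i) <=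
    \sum_(i in B) pm (g (state x) i x == x i) + #|~: B|%:R :> R.
  rewrite (bigID (fun i => i \in B)) /=; apply: lerD.
    by rewrite le_eqVlt; apply/orP; left; apply/eqP; apply: eq_bigr => i _; rewrite answerE.
  rewrite -sum1_card natr_sum [leLHS](eq_bigl (fun i => i \in ~: B)); last by move=> i; rewrite finset.in_setC.
  by apply: ler_sum => i _; rewrite /pm; case: ifP => _; lra.
apply: (le_trans (ler_sum _ (fun x _ => split_sum x))).
rewrite big_split /= sumr_const -[X in _ + X]mulr_natl.
rewrite card_ffun card_bool card_ord natrX mulrDr lerD2r.
apply: (le_trans adv); rewrite ler_wpM2l ?exprn_ge0// lerD2r ler_wpM2l//; first by lra.
by rewrite ler_nat -[leqRHS]card_ord max_card.
Qed.

(** A correctness indicator is [(1 + pm) / 2]. On average over the orders half of the bits are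
    conceded, whence [(1 + 1/2) / 2 = 3/4]; the remaining terms come from the memory. *)
Lemma sum_answer_correct {R : realType} {m L s : nat}
    {A : stream_alg R s #|vertex m L|} (w : seed A) (t : R) :
  0 < t <= 2^-1 ->
  \sum_x \sum_i \sum_(st <- permutations (enum (vertex m L)))
      (answer_bit w x i st == x i)%:R
    <= 2 ^+ m * ((#|vertex m L|)`!)%:R * (m%:R * (3 / 4 + t) + s%:R / (2 * t)) :> R.
Proof.
move=> /[dup] /andP[t0 _] ht; have := @sum_card_data_before_hub m L.
have : size (permutations (enum (vertex m L))) = (#|vertex m L|)`!.
  by rewrite size_permutations ?enum_uniq// -cardE.
set P := permutations _; set K := (#|_|)`!; move: K => K sizeP sumB.
have Bsum : \sum_(st <- P) #|~: data_before_hub st|%:R = m%:R * K%:R / 2 :> R.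
  have h : (2 * \sum_(st <- P) #|~: data_before_hub st| = m * K)%N.
    apply/eqP; rewrite -(eqn_add2l (2 * \sum_(st <- P) #|data_before_hub st|)).
    rewrite {2}sumB -mulnDr -big_split /=.
    under eq_bigr do rewrite cardsC card_ord.
    by rewrite big_const_seq count_predT iter_addn_0 sizeP addnn mul2n.
  by have := congr1 (fun n => n%:R : R) h; rewrite !natrM natr_sum => <-; field.
have hx (st : seq (vertex m L)) : st \in P ->
   \sum_x \sum_i (answer_bit w x i st == x i)%:R <=
   2 ^+ m * (m%:R + (2 * t * m%:R + s%:R / t + #|~: data_before_hub st|%:R)) / 2 :> R.
  rewrite mem_permutations => hst.
  have ust : uniq st by rewrite (perm_uniq hst) enum_uniq.
  have hubst : hub \in st by rewrite (perm_mem hst) mem_enum.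
  have := answer_bit_advantage w ust hubst ht.
  have -> : \sum_x \sum_i (answer_bit w x i st == x i)%:R =
     (2 ^+ m * m%:R + \sum_x \sum_i pm (answer_bit w x i st == x i)) / 2 :> R.
    have -> : 2 ^+ m * m%:R = \sum_(x : {ffun 'I_m -> bool}) \sum_(i < m) 1 :> R.
      by rewrite !sumr_const card_ffun card_bool !card_ord -natrX mulr_natl.
    rewrite -big_split /= mulr_suml; apply: eq_bigr => x _.
    rewrite -big_split /= mulr_suml; apply: eq_bigr => i _.
    by rewrite /pm; case: (_ == _) => /=; lra.
  by rewrite [in leRHS]mulrDr; lra.
under eq_bigr do rewrite exchange_big /=.
rewrite exchange_big /= big_seq.
apply: (le_trans (ler_sum _ hx)). rewrite -big_seq -mulr_suml -mulr_sumr big_split /=.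
rewrite big_split /= Bsum !big_const_seq !count_predT !iter_addr_0 sizeP.
rewrite -(mulr_natr m%:R K) -(mulr_natr (_ + _ / _) K) le_eqVlt; apply/orP; left; apply/eqP; field.
by rewrite gt_eqF.
Qed.

(** Successes are counted over all inputs, queries and orders: from below by the guarantee for each
    instance, from above by [sum_answer_correct] at each seed, since by [sep] an accurate estimate
    yields the right bit. *)
Lemma index_graph_space {R : realType} {m L s : nat}
    {A : stream_alg R s #|vertex m L|} {target : {ffun 'I_m -> bool} -> 'I_m -> R}
    {eps delta t : R} :
  0 < t <= 2^-1 ->
  (forall (x : {ffun 'I_m -> bool}) (i : 'I_m), if x i then 2^-1 + eps < target x i else target x i < 2^-1 - eps) ->
  (forall x i, ((1 - delta)%:E <=
     @random_order_success R s (index_graph L x i) A eps (target x i))%E) ->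
  m%:R * (1 - delta) <= m%:R * (3 / 4 + t) + s%:R / (2 * t).
Proof.
move=> ht sep succ; set V := vertex m L.
set P := permutations (enum V).
pose good (o : {ffun 'I_m -> bool} * 'I_m * seq V) : set (seed A) :=
  [set w | `|run w [seq fun_edge (wire o.1.1 (data o.1.2)) v | v <- o.2]
           - target o.1.1 o.1.2| <= eps]%classic.
have mgood o : measurable (good o).
  pose f (w : seed A) : R := `|run w [seq fun_edge (wire o.1.1 (data o.1.2)) v | v <- o.2]
           - target o.1.1 o.1.2|.
  have mf : measurable_fun [set: seed A] f.
    apply: measurableT_comp => //; apply: measurable_funB => //.
    exact: output_measurable.
  have -> : good o = ([set: seed A] `&` f @^-1` `]-oo, eps])%classic.
    by apply/seteqP; split => w /=; rewrite /good /= in_itv /= => // -[].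
  exact: mf.
have good_answer x i st w : good (x, i, st) w -> answer_bit w x i st == x i.
  rewrite /good /= ler_norml => /andP[lo hi]; have := sep x i.
  rewrite /answer_bit; case: (x i) => h; apply/eqP; first by lra.
  by apply/negbTE; rewrite -leNgt; lra.
pose K := (#|V|)`!.
have K0 : 0 < K%:R :> R by rewrite ltr0n fact_gt0.
pose r := [seq (o, st) | o <- enum {: {ffun 'I_m -> bool} * 'I_m}, st <- P].
have upper : (\sum_(o <- r) seed_law A (good o) <=
    (2 ^+ m * K%:R * (m%:R * (3 / 4 + t) + s%:R / (2 * t)))%:E)%E.
  apply: sum_probability_le => // w.
  rewrite big_allpairs big_enum /= -(pair_bigA _ (fun x i => \sum_(st <- P) \1_(good (x, i, st)) w)) /=.
  apply: (le_trans _ (sum_answer_correct w _ ht)).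
  apply: ler_sum => x _; apply: ler_sum => i _; apply: ler_sum => st _.
  rewrite indicE; case: (boolP (w \in _)) => //; rewrite in_setE => /good_answer ->.
  by [].
have lower : ((2 ^+ m * m%:R * (K%:R * (1 - delta)))%:E <= \sum_(o <- r) seed_law A (good o))%E.
  rewrite big_allpairs big_enum /=.
  apply: (@le_trans _ _ (\sum_(o : {ffun 'I_m -> bool} * 'I_m) (K%:R * (1 - delta))%:E)%E).
    rewrite sumEFin lee_fin sumr_const -[leRHS]mulr_natl card_prod card_ffun card_bool.
    by rewrite !card_ord natrM natrX.
  apply: lee_sum => -[x i] _; have := succ x i.
  rewrite random_order_success_fun_digraph -/V -/P -/K => h.
  by rewrite EFinM -lee_pdivlMl.
have := le_trans lower upper; rewrite lee_fin.
have -> : 2 ^+ m * m%:R * (K%:R * (1 - delta)) = 2 ^+ m * K%:R * (m%:R * (1 - delta)) by ring.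
by rewrite ler_pM2l// mulr_gt0// exprn_gt0.
Qed.

(** * Choice of the parameters and the linear bound *)

Theorem theorem1p8 (R : realType) (alpha eps delta : R) :
  0 < alpha -> alpha <= 1 ->
  eps < (1 - alpha) ^+ 3 - 2^-1 ->
  delta < 4^-1 ->
  exists (c : R) (n0 : nat), 0 < c /\
    forall n : nat, (n0 <= n)%N ->
      exists F : set digraph,
        (forall G : digraph, F G ->
           [/\ (nverts G <= n)%N, (#|edges G| <= n)%N &
               forall v : 'I_(nverts G), (0 < outdeg v)%N]) /\
        forall (s : nat) (A : forall N : nat, {set 'I_N} -> stream_alg R s N),
          approximates_pagerank A F alpha eps delta ->
          c * n%:R <= s%:R.
Proof.
move=> a0 a1 heps hdelta; have ha : 0 < alpha <= 1 by rewrite a0.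
pose eta := (1 - alpha) ^+ 3 - 2^-1 - eps.
have eta0 : 0 < eta by rewrite /eta; lra.
(* One vertex in [k] will carry data: [k * eta > 2] keeps the lost PageRank below the slack [eta],
   and [k >= 2] leaves room for the other vertices. *)
pose k := (Num.Def.archi_bound (2 / eta)).+2.
have k_eta : 2 < k%:R * eta.
  rewrite -ltr_pdivrMr//; apply: (lt_trans (archi_boundP _)).
    by rewrite divr_ge0// ltW.
  by rewrite ltr_nat /k.
have k2 : (2 <= k)%N by [].
have k2R : 2 <= k%:R :> R by rewrite ler_nat.
clearbody k.
(* The excess of the success probability over 3/4, capped so that [t = gamma / 2] is admissible even
   for negative [delta]. *)
pose gamma := Num.min (4^-1 - delta) 4^-1.
have gamma0 : 0 < gamma by rewrite lt_min; apply/andP; split; lra.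
have gammad : gamma <= 4^-1 - delta by rewrite ge_min lexx.
have gamma4 : gamma <= 4^-1 by rewrite ge_min lexx orbT.
clearbody gamma.
(* The final bound is [s >= gamma^2 * m / 2], and [n >= 5 k] gives [n <= 2 m k]; it also absorbs the
   five extra vertices. *)
exists (gamma ^+ 2 / (4 * k%:R)), (5 * k)%N; split.
  by rewrite divr_gt0 ?exprn_gt0 ?mulr_gt0//; lra.
(* The 5 counts the four cycle vertices and the hub, so the graphs have exactly [n] vertices. *)
move=> n hn; pose m := (n %/ k)%N; pose L := (n - (m + 5))%N.
have mk : (m * k <= n)%N by apply: leq_trunc_div.
have mk1 : (n < m.+1 * k)%N by apply: ltn_ceil; apply: ltnW.
have hL : (m + L + 5)%N = n by rewrite /L; have := leq_mul (leqnn m) k2; lia.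
have mkR : m%:R * k%:R <= n%:R :> R by rewrite -natrM ler_nat.
have mk1R : n%:R < (m%:R + 1) * k%:R :> R by rewrite natr1 -natrM ltr_nat.
have hnR : 5 * k%:R <= n%:R :> R by rewrite -(natrM _ 5) ler_nat.
have hLR : m%:R + L%:R + 5 = n%:R :> R by rewrite -hL !natrD.
have cardV : #|vertex m L| = n by rewrite card_vertex.
clearbody m L.
exists [set G | exists x i, G = @index_graph m L x i]%classic; split.
  move=> G [x [i ->]]; split=> [||v]; first by rewrite /= cardV.
    by rewrite card_edges_fun_digraph cardV.
  by rewrite outdeg_fun_digraph.
move=> s A approx.
(* The guarantee speaks only about actual PageRank vectors, so one is chosen for each instance. *)
have pr (x : {ffun 'I_m -> bool}) (i : 'I_m) : {p : 'rV[R]_(nverts (index_graph L x i)) | is_pagerank alpha p}.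
  apply: cid; apply: pagerank_exists => //=; last by move=> v; rewrite outdeg_fun_digraph.
  by apply/card_gt0P; exists hub.
pose target (x : {ffun 'I_m -> bool}) (i : 'I_m) : R := set_pagerank (sval (pr x i)) (cycle_set true).
have n0R : 0 < n%:R :> R by lra.
have cycle_ge (x : {ffun 'I_m -> bool}) (i : 'I_m) : 2^-1 + eps < set_pagerank (sval (pr x i)) (cycle_set (x i)).
  apply: (lt_le_trans _ (index_graph_pagerank_ge x i alpha _ ha (svalP (pr x i)))).
  rewrite cardV; set q := (1 - alpha) ^+ 3.
  have q1 : 0 <= q <= 1 by rewrite exprn_ge0 ?exprn_ile1//; lra.
  rewrite mulrA ltr_pdivlMr//.
  have -> : 2^-1 + eps = q - eta by rewrite /eta -/q; ring.
  have m5 : m%:R + 5 < eta * n%:R.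
    rewrite -(@ltr_pM2l _ k%:R); last by lra.
    apply: (@le_lt_trans _ _ (2 * n%:R)); first by lra.
    by rewrite mulrA ltr_pM2r.
  have : q * (m%:R + 5) <= m%:R + 5 by case/andP: q1 => _ q1; rewrite ler_piMl// addr_ge0.
  have -> : L%:R = n%:R - (m%:R + 5) :> R by lra.
  lra.
(* One query set decides both cases: when the bit is false, the large PageRank of the other cycle
   bounds this one from above. *)
have sep (x : {ffun 'I_m -> bool}) (i : 'I_m) : if x i then 2^-1 + eps < target x i else target x i < 2^-1 - eps.
  have := cycle_ge x i; have := cycle_set_pagerankD _ true (svalP (pr x i)).1.
  by rewrite /target; case: (x i) => //= ? ?; lra.
have succ (x : {ffun 'I_m -> bool}) (i : 'I_m) : ((1 - delta)%:E <= @random_order_success R s (index_graph L x i)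
    (A #|vertex m L| (cycle_set true)) eps (target x i))%E.
  apply: (approx (index_graph L x i)); last exact: svalP.
  by exists x, i.
have ht : 0 < gamma / 2 <= 2^-1 by apply/andP; split; lra.
have := index_graph_space ht sep succ.
have -> : s%:R / (2 * (gamma / 2)) = s%:R / gamma by field; lra.
move=> h.
have : m%:R * (gamma / 2) <= s%:R / gamma by nra.
rewrite ler_pdivlMr// => hs.
rewrite mulrAC ler_pdivrMr; last by lra.
apply: (@le_trans _ _ (gamma ^+ 2 * (2 * m%:R * k%:R))).
  rewrite ler_wpM2l ?exprn_ge0//; last by lra.
  nra.
nra.
Qed.
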